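(* Let $f\colon M^{2n}\to\mathbb{H}^{2n+p}$, $p\leq n-2$, be an isometric immersion of a Kaehler manifold $M^{2n}$ of real dimension $2n$ with complex structure $J$. Then at each point $x\in M^{2n}$ there is a $J$-invariant subspace $L^{2m}\subset T_xM$ of real dimension $2m$, with $m\geq n-p-1$, such that the holomorphic sectional curvature of any complex plane $P\subset L^{2m}$ satisfies $K_P\leq 0$.
   Context: $\mathbb{H}^{N}$ denotes the $N$-dimensional hyperbolic space of constant sectional curvature $-1$. A complex plane $P\subset T_xM$ is a real two-dimensional $J$-invariant subspace, $P=\mathrm{span}\{Z,JZ\}$ with $Z\neq 0$, and $K_P$ is its sectional curvature in $M^{2n}$. Isometric immersions are isometric only for the Riemannian metrics. *)

(* Defs.v *)
From HB Require Import structures.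
From mathcomp Require Import all_boot all_order all_algebra.
From mathcomp Require Import all_classical all_reals all_analysis.

Set Implicit Arguments.
Unset Strict Implicit.
Unset Printing Implicit Defensive.

Import Order.TTheory GRing.Theory Num.Theory.
Import numFieldNormedType.Exports.

Local Open Scope classical_set_scope.
Local Open Scope ring_scope.

Section Smoothness.
Variables (R : realType) (V W : normedModType R).

Fixpoint differentiable_upto (k : nat) (U : set V) (f : V -> W) : Prop :=
  if k is k'.+1 then
    (forall x, U x -> differentiable f x) /\
    (forall v : V, differentiable_upto k' U (fun x => 'D_v f x))
  else True.

(* For open [U] this is C^oo: each derivative is continuous on [U], being
   itself differentiable there. *)
Definition smooth_on (U : set V) (f : V -> W) : Prop :=
  forall k : nat, differentiable_upto k U f.

End Smoothness.

(* The manifold is given by a (not necessarily maximal) smooth atlas.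
   [chart i] and [param i] are only meaningful on [chart_dom i] and on the image
   [chart i @` chart_dom i] respectively, where they are mutually inverse. *)
Record smooth_manifold (R : realType) (d : nat) := SmoothManifold {
  carrier :> topologicalType;
  chart_index : Type;
  chart_dom : chart_index -> set carrier;
  chart : chart_index -> carrier -> 'rV[R]_d;
  param : chart_index -> 'rV[R]_d -> carrier;
  manifold_hausdorff : hausdorff_space carrier;
  manifold_second_countable : @second_countable carrier;
  chart_dom_open : forall i, open (chart_dom i);
  chart_dom_cover : forall x, exists i, chart_dom i x;
  chart_image_open : forall i, open (chart i @` chart_dom i);
  chart_continuous : forall i, {within chart_dom i, continuous (chart i)};
  param_continuous :
    forall i, {within chart i @` chart_dom i, continuous (param i)};
  chartK : forall i x, chart_dom i x -> param i (chart i x) = x;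
  transition_smooth : forall i j,
    smooth_on (chart i @` (chart_dom i `&` chart_dom j)) (chart j \o param i)
}.

(* Calculus in a single chart.  Tangent vectors are rows of components with
   respect to the coordinate frame d_0, ..., d_(d-1), and [G y] is the Gram
   matrix of the metric in that frame at the point of coordinates [y]. *)
Section LocalRiemannianGeometry.
Variables (R : realType) (d : nat) (G : 'rV[R]_d -> 'M[R]_d).
Implicit Types (y u v X Y Z : 'rV[R]_d) (i j k l : 'I_d).

Definition pderiv i (h : 'rV[R]_d -> R) y : R := 'D_(delta_mx 0 i) h y.

Definition inner y u v : R := (u *m G y *m v^T) 0 0.

(* nabla_(d_i) d_j = \sum_k (christoffel k i j) d_k *)
Definition christoffel k i j y : R :=
  2^-1 * \sum_l invmx (G y) k l *
    (pderiv i (fun z => G z j l) y + pderiv j (fun z => G z i l) y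
     - pderiv l (fun z => G z i j) y).

(* R(d_i, d_j) d_k = \sum_l (curvature_coef l i j k) d_l, with the convention
   R(X, Y) = [nabla_X, nabla_Y] - nabla_[X, Y] *)
Definition curvature_coef l i j k y : R :=
  pderiv i (christoffel l j k) y - pderiv j (christoffel l i k) y
  + \sum_e (christoffel e j k y * christoffel l i e y
            - christoffel e i k y * christoffel l j e y).

Definition curvature y X Y Z : 'rV[R]_d :=
  \row_l \sum_i \sum_j \sum_k
    X 0 i * Y 0 j * Z 0 k * curvature_coef l i j k y.

Definition sectional_curvature y X Y : R :=
  inner y (curvature y X Y Y) X /
  (inner y X X * inner y Y Y - inner y X Y ^+ 2).

(* An endomorphism field acts on rows from the right: the image of d_a is
   \sum_b (J y a b) d_b.  [covariant_deriv J c a b y] is then the d_b component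
   of (nabla_(d_c) J) d_a = nabla_(d_c) (J d_a) - J (nabla_(d_c) d_a). *)
Definition covariant_deriv (J : 'rV[R]_d -> 'M[R]_d) (c a b : 'I_d) y : R :=
  pderiv c (fun z => J z a b) y
  + \sum_e (J y a e * christoffel b c e y - christoffel e c a y * J y e b).

End LocalRiemannianGeometry.

Section KaehlerManifolds.
Variables (R : realType) (d : nat) (M : smooth_manifold R d).

Definition chart_image (i : chart_index M) : set 'rV[R]_d :=
  chart i @` chart_dom i.

(* If [u] is the row of components in chart [i] of a tangent vector at the point
   of coordinates [y], then [u *m change i j y] is its row in chart [j]. *)
Definition change (i j : chart_index M) (y : 'rV[R]_d) : 'M[R]_d :=
  jacobian (@chart R d M j \o @param R d M i) y.

(* Tensor fields of type (0,2) and (1,1) are given by their components in every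
   chart of the atlas; the last clause of each of the next two records is the
   compatibility with changes of charts. *)
Record is_riemannian_metric
    (g : chart_index M -> 'rV[R]_d -> 'M[R]_d) : Prop := {
  metric_smooth : forall i, smooth_on (chart_image i) (g i);
  metric_sym : forall i y, chart_image i y -> (g i y)^T = g i y;
  metric_posdef : forall i y, chart_image i y ->
    forall u : 'rV[R]_d, u != 0 -> 0 < inner (g i) y u u;
  metric_compat : forall i j x, chart_dom i x -> chart_dom j x ->
    g i (chart i x) =
      change i j (chart i x) *m g j (chart j x) *m (change i j (chart i x))^T
}.

Record is_endomorphism_field
    (J : chart_index M -> 'rV[R]_d -> 'M[R]_d) : Prop := {
  endo_smooth : forall i, smooth_on (chart_image i) (J i);
  endo_compat : forall i j x, chart_dom i x -> chart_dom j x ->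
    J i (chart i x) *m change i j (chart i x) =
      change i j (chart i x) *m J j (chart j x)
}.

Record is_kaehler (g J : chart_index M -> 'rV[R]_d -> 'M[R]_d) : Prop := {
  kaehler_metric : is_riemannian_metric g;
  kaehler_endo : is_endomorphism_field J;
  kaehler_square : forall i y, chart_image i y -> J i y *m J i y = - 1%:M;
  kaehler_orthogonal : forall i y, chart_image i y ->
    forall u v : 'rV[R]_d,
      inner (g i) y (u *m J i y) (v *m J i y) = inner (g i) y u v;
  kaehler_parallel : forall i y, chart_image i y ->
    forall c a b : 'I_d, covariant_deriv (g i) (J i) c a b y = 0
}.

End KaehlerManifolds.

Section HyperbolicSpace.
Variables (R : realType) (N : nat).

Definition lorentz (u v : 'rV[R]_N.+1) : R :=
  - (u 0 ord0 * v 0 ord0) + \sum_(k < N) u 0 (lift ord0 k) * v 0 (lift ord0 k).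

(* Hyperboloid model; the Riemannian metric of the hyperbolic space is the
   restriction of [lorentz] to the tangent spaces of this hypersurface. *)
Definition hyperbolic_space : set 'rV[R]_N.+1 :=
  [set u | lorentz u u = -1 /\ 0 < u 0 ord0].

Record is_isometric_immersion_hyperbolic (d : nat) (M : smooth_manifold R d)
    (g : chart_index M -> 'rV[R]_d -> 'M[R]_d)
    (f : M -> 'rV[R]_N.+1) : Prop := {
  immersion_range : forall x, hyperbolic_space (f x);
  immersion_smooth : forall i : chart_index M,
    smooth_on (chart_image i) (f \o @param R d M i);
  immersion_injective : forall (i : chart_index M) y, chart_image i y ->
    row_free (jacobian (f \o @param R d M i) y);
  immersion_isometric : forall (i : chart_index M) y, chart_image i y ->
    forall u v : 'rV[R]_d,
      lorentz ('D_u (f \o @param R d M i) y) ('D_v (f \o @param R d M i) y)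
      = inner (g i) y u v
}.

End HyperbolicSpace.

Section ComplexSubspaces.
Variables (R : realType) (d : nat) (A : 'M[R]_d).

Definition invariant_subspace (L : {vspace 'rV[R]_d}) : Prop :=
  forall v : 'rV[R]_d, v \in L -> v *m A \in L.

Definition complex_plane (P : {vspace 'rV[R]_d}) : Prop :=
  \dim P = 2%N /\ invariant_subspace P.

End ComplexSubspaces.

(* Main.v *)
Require Import Defs.
From HB Require Import structures.
From mathcomp Require Import all_boot all_order all_algebra.
From mathcomp Require Import all_classical all_reals all_analysis.
From mathcomp Require Import perm ring lra.

Set Implicit Arguments.
Unset Strict Implicit.
Unset Printing Implicit Defensive.

Import Order.TTheory GRing.Theory Num.Theory.
Import numFieldNormedType.Exports.

Local Open Scope classical_set_scope.
Local Open Scope ring_scope.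

(** Put the hyperbolic space in the Lorentz space of dimension 2n+p+1 as the
    hyperboloid, and let [beta] be the second fundamental form of M seen as a
    submanifold of that flat space.  At a point it takes its values in a
    Lorentzian space of dimension p+1, spanned by the normal space of M in the
    hyperbolic space and by the position vector F, and
    <beta(X,Y), F> = - g(X,Y).  The Gauss equation ([gauss_equation]) reads
<<
      <R(X,Y)Z, W> = <beta(Y,Z), beta(X,W)> - <beta(X,Z), beta(Y,W)>.
>>
    Since J is parallel, R(X,Y) commutes with J ([curvature_parallel]).  Hence
    the Hermitian form
<<
      h(X,Y) = beta(X,Y) + beta(JX,JY) + i (beta(X,JY) - beta(JX,Y))
>>
    with values in the complexification of that Lorentzian space is flat: by
    [hermitian_flat] the pairing of h(X,Y) with h(Z,T) does not change when Y
    and T are exchanged.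

    Choose X such that the linear map h(X, .) has the largest possible rank and
    let L be its kernel.  It is J-invariant, and as the rank is at most 2(p+1)
    its real dimension is at least 2n-2(p+1).  By maximality of the rank,
    h(Y, .) maps L into the image of h(X, .) for every Y
    ([pencil_kernel_image]); so for Z in L we may write h(Z,Z) = h(X,W), and
    flatness gives <h(Z,Z), h(Z,Z)> = <h(X,Z), h(Z,W)> = 0
    ([regular_kernel_null]).  As h(Z,Z) is the real vector a + b, where
    a = beta(Z,Z) and b = beta(JZ,JZ), this says that a + b is a null vector.

    Finally, for Z in L the curvature of span(Z,JZ) has the sign of
<<
      <a,b> - |beta(Z,JZ)|^2 = - |a-b|^2 / 4 - |beta(Z,JZ)|^2.
>>
    Both a - b and beta(Z,JZ) are orthogonal to the timelike vector F, because
    g(Z,Z) = g(JZ,JZ) and g(Z,JZ) = 0.  They are therefore spacelike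
    ([lorentz_orthogonal_ge0]), and the curvature is nonpositive.

    The analytic part consists of the equality of mixed derivatives
    ([derive_comm_mx]), used for the second and third derivatives of F and for
    the second derivatives of J, and of a product rule for matrices. *)

(** * Derivatives of matrix-valued maps *)

Section MatrixCalculus.
Variables (R : realType) (V : normedModType R).
Implicit Types (x v : V).

Lemma is_derive_mxP m n (A : V -> 'M[R]_(m, n)) (dA : 'M[R]_(m, n)) x v :
  is_derive x v A dA <->
  forall i j, is_derive x v (fun y => A y i j) (dA i j).
Proof.
split=> [[dAx <-] i j|H].
  split; first by have /derivable_mxP := dAx; exact.
  by rewrite derive_mx // mxE.
have dAx : derivable A x v by apply/derivable_mxP => i j; apply: ex_derive.
split => //; apply/matrixP => i j.
by rewrite derive_mx // mxE (@derive_val _ _ _ _ _ _ _ (H i j)).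
Qed.

Lemma is_derive_fsum (I : Type) (r : seq I) (h : I -> V -> R) (dh : I -> R)
    x v : (forall i, is_derive x v (h i) (dh i)) ->
  is_derive x v (fun y => \sum_(i <- r) h i y) (\sum_(i <- r) dh i).
Proof.
move=> H; elim: r => [|a r IH].
  rewrite big_nil.
  have -> : (fun y => \sum_(i <- [::]) h i y) = cst (0 : R).
    by apply/funext => y; rewrite big_nil.
  exact: is_derive_cst.
rewrite big_cons.
have -> : (fun y => \sum_(i <- a :: r) h i y) =
          h a + (fun y => \sum_(i <- r) h i y).
  by apply/funext => y; rewrite big_cons.
exact: is_deriveD.
Qed.

Lemma is_derive_mulmx m n p (A : V -> 'M[R]_(m, n)) (B : V -> 'M[R]_(n, p))
    dA dB x v : is_derive x v A dA -> is_derive x v B dB ->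
  is_derive x v (fun y => A y *m B y) (dA *m B x + A x *m dB).
Proof.
move=> /is_derive_mxP HA /is_derive_mxP HB; apply/is_derive_mxP => i j.
rewrite !mxE -big_split /=.
have -> : (fun y => (A y *m B y) i j) = (fun y => \sum_k (A y i k * B y k j)).
  by apply/funext => y; rewrite mxE.
apply: is_derive_fsum => k.
have M := @is_deriveM _ _ _ _ _ _ _ _ (HA i k) (HB k j).
by apply: is_derive_eq M _; rewrite addrC [_ *: dA i k]mulrC.
Qed.

Lemma is_derive_mulmxr m n p (A : V -> 'M[R]_(m, n)) (B : 'M[R]_(n, p)) dA x v :
  is_derive x v A dA -> is_derive x v (fun y => A y *m B) (dA *m B).
Proof.
move=> HA; have M := is_derive_mulmx HA (is_derive_cst B x v).
by apply: is_derive_eq M _; rewrite mulmx0 addr0.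
Qed.

Lemma is_derive_trmx m n (A : V -> 'M[R]_(m, n)) dA x v :
  is_derive x v A dA -> is_derive x v (fun y => (A y)^T) dA^T.
Proof.
move=> /is_derive_mxP HA; apply/is_derive_mxP => i j.
rewrite mxE; have -> : (fun y => (A y)^T i j) = fun y => A y j i.
  by apply/funext => y; rewrite mxE.
exact: HA.
Qed.

Lemma derivable_fsum (I : Type) (r : seq I) (h : I -> V -> R) x v :
  (forall i, derivable (h i) x v) ->
  derivable (fun y => \sum_(i <- r) h i y) x v.
Proof.
move=> H; have K i : is_derive x v (h i) ('D_v (h i) x) by apply: derivableP.
by case: (is_derive_fsum r K).
Qed.

Lemma derivable_fprod (I : Type) (r : seq I) (h : I -> V -> R) x v :
  (forall i, derivable (h i) x v) ->
  derivable (fun y => \prod_(i <- r) h i y) x v.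
Proof.
move=> H; elim: r => [|a r IH].
  have -> : (fun y => \prod_(i <- [::]) h i y) = cst (1 : R).
    by apply/funext => y; rewrite big_nil.
  exact: derivable_cst.
have -> : (fun y => \prod_(i <- a :: r) h i y) =
          h a * (fun y => \prod_(i <- r) h i y).
  by apply/funext => y; rewrite big_cons.
apply: derivableM; [exact: H|exact: IH].
Qed.

Lemma derivable_det n (A : V -> 'M[R]_n) x v :
  derivable A x v -> derivable (fun y => \det (A y)) x v.
Proof.
move=> /derivable_mxP HA; apply: derivable_fsum => s.
have -> : (fun y => (-1) ^+ s * \prod_i A y i (s i)) =
          cst ((-1) ^+ s) * (fun y => \prod_i A y i (s i)) by [].
apply: derivableM; first exact: derivable_cst.
by apply: derivable_fprod => i; apply: HA.
Qed.

(** Near [x] the inverse is the adjugate divided by the determinant, both of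
    which are polynomials in the entries. *)
Lemma derivable_invmx n (A : V -> 'M[R]_n) x v :
  derivable A x v -> (\near x, A x \in unitmx) ->
  derivable (fun y => invmx (A y)) x v.
Proof.
move=> HA uA; have uAx := nbhs_singleton uA.
apply: (@near_eq_derivable _ _ _ (fun y => (\det (A y))^-1 *: \adj (A y))).
  by apply: filterS uA => y uAy; rewrite /invmx uAy.
apply/derivable_mxP => i j.
have -> : (fun y => ((\det (A y))^-1 *: \adj (A y)) i j) =
          (fun y => (\det (A y))^-1) *
          (cst ((-1) ^+ (j + i)) * (fun y => \det (row' j (col' i (A y))))).
  by apply/funext => y; rewrite !mxE.
apply: derivableM.
  apply: derivableV; last exact: derivable_det.
  by rewrite -unitfE -unitmxE.
apply: derivableM; first exact: derivable_cst.
apply: derivable_det; apply/derivable_mxP => a b.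
move/derivable_mxP : HA => HA.
have -> : (fun y => row' j (col' i (A y)) a b) =
          (fun y => A y (lift j a) (lift i b)).
  by apply/funext => y; rewrite !mxE.
exact: HA.
Qed.

End MatrixCalculus.

(** * Equality of mixed derivatives *)

Lemma near_of_scaled_eq (R : realType) (t a b c c' e : R) (s s' : R) :
  0 < t -> s = t ^+ 2 * c -> s' = t ^+ 2 * c' -> s = s' ->
  `|a - c| < e / 2 -> `|b - c'| < e / 2 -> `|a - b| <= e.
Proof.
move=> t0 -> -> /(mulfI (lt0r_neq0 (exprn_gt0 2 t0))) <- ac bc.
rewrite (_ : a - b = (a - c) - (b - c)); last by ring.
by rewrite (le_trans (ler_normB _ _)); lra.
Qed.

Section Schwarz.
Variables (R : realType) (V : normedModType R).

Lemma is_derive_along_line (h : V -> R) (z u : V) (s : R) :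
  derivable h (s *: u + z) u ->
  is_derive s 1 (fun r : R => h (r *: u + z)) ('D_u h (s *: u + z)).
Proof.
move=> dh.
have E : (fun k : R => k^-1 *: (((fun r : R => h (r *: u + z)) \o shift s)
      (k *: (1 : R)) - h (s *: u + z))) =
   (fun k => k^-1 *: ((h \o shift (s *: u + z)) (k *: u) - h (s *: u + z))).
  by apply/funext => k /=; rewrite [k%:A]mulr1 scalerDl addrA.
by split; rewrite /derivable /derive E.
Qed.

(** The mean value theorem is applied twice: to s |-> h(x+su+tv) - h(x+su), and
    then to the derivative of h along [u], on the segment directed by [v]. *)
Lemma second_difference_mean_value (h : V -> R) (x u v : V) (t : R) :
  0 < t ->
  (forall a b, 0 <= a <= t -> 0 <= b <= t ->
     derivable h (x + a *: u + b *: v) u /\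
     derivable ('D_u h) (x + a *: u + b *: v) v) ->
  exists a b, [/\ 0 <= a <= t, 0 <= b <= t &
   h (x + t *: u + t *: v) - h (x + t *: u) - h (x + t *: v) + h x =
   t ^+ 2 * 'D_v ('D_u h) (x + a *: u + b *: v)].
Proof.
move=> t0 H.
pose phi := (fun s : R => h (s *: u + (x + t *: v))) - (fun s => h (s *: u + x)).
pose dphi (s : R) := 'D_u h (s *: u + (x + t *: v)) - 'D_u h (s *: u + x).
have tt : 0 <= t <= t by rewrite lexx ltW.
have zz : 0 <= (0 : R) <= t by rewrite lexx ltW.
have dphiP s : 0 <= s <= t -> is_derive s 1 phi (dphi s).
  move=> st; apply: is_deriveB; apply: is_derive_along_line.
    have E : x + s *: u + t *: v = s *: u + (x + t *: v) by rewrite addrCA addrA.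
    by have [+ _] := H s t st tt; rewrite E; apply.
  have E : x + s *: u + 0 *: v = s *: u + x by rewrite scale0r addr0 addrC.
  by have [+ _] := H s 0 st zz; rewrite E; apply.
have [a ai Ea] : exists2 a, a \in `]0, t[%R & phi t - phi 0 = dphi a * (t - 0).
  apply: (@MVT _ phi dphi); first exact: t0.
    move=> s /[!in_itv]/= /andP[? ?].
    by apply: dphiP; rewrite !ltW.
  apply: derivable_within_continuous => s /[!in_itv]/= st.
  by case: (dphiP _ st).
have {}ai : 0 <= a <= t by move: ai; rewrite in_itv /= => /andP[? ?]; rewrite !ltW.
pose psi (r : R) := 'D_u h (r *: v + (x + a *: u)).
pose dpsi (r : R) := 'D_v ('D_u h) (r *: v + (x + a *: u)).
have dpsiP s : 0 <= s <= t -> is_derive s 1 psi (dpsi s).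
  move=> st; apply: is_derive_along_line.
  have E : x + a *: u + s *: v = s *: v + (x + a *: u) by rewrite addrC.
  by have [_ +] := H a s ai st; rewrite E; apply.
have [b bi Eb] : exists2 b, b \in `]0, t[%R &
    psi t - psi 0 = dpsi b * (t - 0).
  apply: (@MVT _ psi dpsi); first exact: t0.
    by move=> s /[!in_itv]/= /andP[? ?]; apply: dpsiP; rewrite !ltW.
  apply: derivable_within_continuous => s /[!in_itv]/= st.
  by case: (dpsiP _ st).
have {}bi : 0 <= b <= t by move: bi; rewrite in_itv /= => /andP[? ?]; rewrite !ltW.
exists a, b; split => //.
have Edp : dphi a = psi t - psi 0.
  rewrite /dphi /psi scale0r add0r [a *: u + x]addrC; congr (_ - _).
  by congr ('D_u h _); rewrite [RHS]addrC addrA [a *: u + x]addrC.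
move: Ea; rewrite Edp Eb /dpsi !subr0 -mulrA -expr2 /phi !fctE /=.
rewrite scale0r !add0r [b *: v + _]addrC mulrC => <-.
have -> : x + t *: u + t *: v = t *: u + (x + t *: v) by rewrite addrCA addrA.
rewrite [t *: u + x]addrC; ring.
Qed.

(** The second difference of [h] does not change when [u] and [v] are exchanged.
    So at two points arbitrarily close to [x] the two mixed derivatives take the
    same value, and continuity transports this equality to [x]. *)
Lemma derive_comm (U : set V) (h : V -> R) (x u v : V) :
  open U -> U x ->
  (forall y, U y -> derivable h y u /\ derivable h y v) ->
  (forall y, U y -> derivable ('D_u h) y v /\ derivable ('D_v h) y u) ->
  {for x, continuous ('D_v ('D_u h))} -> {for x, continuous ('D_u ('D_v h))} ->
  'D_v ('D_u h) x = 'D_u ('D_v h) x.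
Proof.
move=> oU Ux H1 H2 c1 c2; apply/eqP; rewrite -subr_eq0 -normr_le0.
apply/ler_addgt0Pr => e e0; rewrite add0r.
have e2 : 0 < e / 2 by lra.
have N : \forall y \near x, [/\ U y,
   `|'D_v ('D_u h) x - 'D_v ('D_u h) y| < e / 2 &
   `|'D_u ('D_v h) x - 'D_u ('D_v h) y| < e / 2].
  move/cvgrPdist_lt : c1 => /(_ _ e2) n1; move/cvgrPdist_lt : c2 => /(_ _ e2) n2.
  have nU : nbhs x U by apply: open_nbhs_nbhs.
  apply: filterS3 nU n1 n2.
  move=> y Uy h1 h2.
  by split; [exact: Uy|exact: h1|exact: h2].
case/nbhs_ballP : N => d /= d0 Hd.
(* This side keeps the parallelogram x + [0,t]u + [0,t]v in the ball of radius d. *)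
pose t := d / (2 * (`|u| + `|v| + 1)).
have n0 : 0 < `|u| + `|v| + 1 by have := normr_ge0 u; have := normr_ge0 v; lra.
have t0 : 0 < t by rewrite divr_gt0 // mulr_gt0.
have Hb a b : 0 <= a <= t -> 0 <= b <= t -> ball x d (x + a *: u + b *: v).
  move=> /andP[a0 a1] /andP[b0 b1].
  rewrite -ball_normE /ball_ /= opprD addrA opprD addrA subrr add0r.
  rewrite (le_lt_trans (ler_normD _ _)) // !normrN !normrZ !ger0_norm //.
  apply: (@le_lt_trans _ _ (t * (`|u| + `|v| + 1) )).
    rewrite !mulrDr mulr1; apply: (@le_trans _ _ (t * `|u| + t * `|v|)).
      by apply: lerD; apply: ler_wpM2r.
    lra.
  rewrite /t; have -> : d / (2 * (`|u| + `|v| + 1)) * (`|u| + `|v| + 1) = d / 2.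
    by field; rewrite gt_eqF.
  lra.
have [a [b [ai bi E1]]] : exists a b, [/\ 0 <= a <= t, 0 <= b <= t &
   h (x + t *: u + t *: v) - h (x + t *: u) - h (x + t *: v) + h x =
   t ^+ 2 * 'D_v ('D_u h) (x + a *: u + b *: v)].
  apply: second_difference_mean_value; first exact: t0.
  move=> a b ai bi; have [Uy _ _] := Hd _ (Hb a b ai bi).
  by split; [exact: (H1 _ Uy).1|exact: (H2 _ Uy).1].
have [b' [a' [bi' ai' E2]]] : exists a b, [/\ 0 <= a <= t, 0 <= b <= t &
   h (x + t *: v + t *: u) - h (x + t *: v) - h (x + t *: u) + h x =
   t ^+ 2 * 'D_u ('D_v h) (x + a *: v + b *: u)].
  apply: second_difference_mean_value; first exact: t0.
  move=> b' a' bi' ai'.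
  have [] := Hd _ (Hb a' b' ai' bi'); rewrite addrAC => Uy _ _.
  by split; [exact: (H1 _ Uy).2|exact: (H2 _ Uy).2].
have [_ D1 _] := Hd _ (Hb a b ai bi).
have [_ _] := Hd _ (Hb a' b' ai' bi'); rewrite addrAC => D2.
apply: (near_of_scaled_eq t0 E1 E2 _ D1 D2).
by rewrite [x + t *: v + t *: u]addrAC; ring.
Qed.

Lemma derive_comm_mx (U : set V) m n (H : V -> 'M[R]_(m, n)) (x u v : V) :
  open U -> smooth_on U H -> U x ->
  'D_v ('D_u H) x = 'D_u ('D_v H) x.
Proof.
move=> oU sH Ux.
have [dH dH1] := sH 1%N.
have dH2 (w : V) y : U y -> differentiable ('D_w H) y.
  by have [_ /(_ w) []] := sH 2%N; move=> + _; apply.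
have dH3 (w w' : V) y : U y -> differentiable ('D_w' ('D_w H)) y.
  by have [_ /(_ w) [_ /(_ w') []]] := sH 3%N; move=> + _; apply.
have nearU y : U y -> \forall z \near y, U z by move=> Uy; apply: open_nbhs_nbhs.
have D1 (w : V) i j y : U y -> 'D_w (fun z => H z i j) y = ('D_w H y) i j.
  move=> Uy; rewrite derive_mx ?mxE //; exact/diff_derivable/dH.
have D2 (w w' : V) i j y : U y ->
    'D_w' ('D_w (fun z => H z i j)) y = ('D_w' ('D_w H) y) i j.
  move=> Uy.
  rewrite (@near_eq_derive _ _ _ _ (fun z => 'D_w H z i j)); last first.
    by apply: filterS (nearU _ Uy) => z /D1.
  have dd : derivable ('D_w H) y w' by apply: diff_derivable; exact: dH2.
  by rewrite (derive_mx dd) mxE.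
have cont (w w' : V) i j :
    {for x, continuous ('D_w' ('D_w (fun z => H z i j)))}.
  have C : {for x, continuous (fun z => ('D_w' ('D_w H) z) i j)}.
    apply: differentiable_continuous.
    apply: (@differentiable_comp _ _ _ _ ('D_w' ('D_w H)) (fun N => N i j)).
      exact: dH3.
    exact: differentiable_coord.
  rewrite /prop_for /continuous_at D2 //.
  apply: cvg_trans C; apply: near_eq_cvg.
  by apply: filterS (nearU _ Ux) => z /D2 ->.
have d1 (w : V) i j y : U y -> derivable (fun z => H z i j) y w.
  by move=> Uy; move: i j; apply/derivable_mxP/diff_derivable/dH.
have d2 (w w' : V) i j y : U y -> derivable ('D_w (fun z => H z i j)) y w'.
  move=> Uy; apply: (@near_eq_derivable _ _ _ (fun z => 'D_w H z i j)).
    by apply: filterS (nearU _ Uy) => z /D1.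
  by move: i j; apply/derivable_mxP/diff_derivable/dH2.
apply/matrixP => i j; apply: (etrans (esym (D2 u v i j x Ux))).
apply: (etrans _ (D2 v u i j x Ux)).
apply: (derive_comm oU Ux); [| |exact: cont|exact: cont].
  by move=> y Uy; split; apply: d1.
by move=> y Uy; split; apply: d2.
Qed.

End Schwarz.

(** * Kernels and complex structures *)

(** If z B were outside the row space of A, adding it to a row basis of A would
    give a row-free matrix, with a right inverse K.  For t <> 0 replace A by
    A + tB in it: all rows now lie in the row space of A + tB, because
    z (A + tB) = t (z B), so the product with K is singular by the rank bound.
    But that product is 1 + tN for a fixed N, hence every s = 1/t would be an
    eigenvalue of - N. *)
Lemma pencil_kernel_image (F : numFieldType) m q (A B : 'M[F]_(m, q))
    (z : 'rV[F]_m) :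
  z *m A = 0 -> (forall t, (\rank (A + t *: B)%R <= \rank A)%N) ->
  (z *m B <= A)%MS.
Proof.
move=> zA rk; apply/negPn/negP => zB.
have /submxP [S defS] : (row_base A <= A)%MS by rewrite eq_row_base.
pose C := col_mx (row_base A) (z *m B).
have freeC : row_free C.
  rewrite /row_free eqn_leq rank_leq_row /= -addsmxE addn1.
  rewrite (adds_eqmx (eq_row_base A) (eqmx_refl (z *m B))).
  suff : (A < A + z *m B)%MS by rewrite ltmxErank => /andP[].
  by rewrite ltmxE addsmxSl /= addsmx_sub negb_and zB orbT.
have [K CK] := row_freeP freeC.
pose N := col_mx (S *m B) (0 : 'rV_q) *m K.
have root_char (s : F) : s != 0 -> root (char_poly (- N)) s.
  move=> s0; rewrite -eigenvalue_root_char.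
  have CsN : col_mx (S *m (A + s^-1 *: B)) (z *m B) *m K = 1%:M + s^-1 *: N.
    rewrite -CK /N scalemxAl -mulmxDl scale_col_mx add_col_mx scaler0 addr0.
    by rewrite mulmxDr -defS -scalemxAr.
  have d0 : \det (1%:M + s^-1 *: N) == 0.
    rewrite -CsN -[_ == 0]negbK -unitfE -unitmxE -row_free_unit /row_free.
    rewrite neq_ltn (leq_ltn_trans (mxrankM_maxl _ _)) //.
    apply: (@leq_ltn_trans (\rank A)); last by rewrite addn1.
    rewrite (leq_trans _ (rk s^-1)) // mxrankS // -addsmxE addsmx_sub.
    apply/andP; split; first exact: submxMl.
    apply/submxP; exists (s *: z).
    rewrite mulmxDr -scalemxAl zA scaler0 add0r.
    by rewrite -scalemxAl -scalemxAr scalerA mulfV ?scale1r.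
  have [v v0 Ev] := det0P d0.
  apply/eigenvalueP; exists v => //.
  move: Ev; rewrite mulmxDr mulmx1 -scalemxAr mulmxN => /eqP.
  rewrite addr_eq0 => /eqP {2}->.
  by rewrite scalerN scalerA mulfV ?scale1r.
have p0 : char_poly (- N) != 0 by apply/monic_neq0/char_poly_monic.
pose rs : seq F := [seq i.+1%:R | i <- iota 0 (size (char_poly (- N)))].
have /(max_poly_roots p0) : all (root (char_poly (- N))) rs.
  by apply/allP => _ /mapP [k _ ->]; rewrite root_char ?pnatr_eq0.
rewrite size_map size_iota ltnn => H; suff : false by []; apply: H.
by rewrite map_inj_uniq ?iota_uniq // => a b /eqP; rewrite eqr_nat eqSS => /eqP.
Qed.

Lemma vspace_of_kernel (F : fieldType) d q (A : 'M[F]_(d, q)) :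
  exists2 L : {vspace 'rV[F]_d},
    (forall v, (v \in L) = (v *m A == 0)) & \dim L = (d - \rank A)%N.
Proof.
pose K := row_base (kermx A).
pose X := [tuple row i K | i < \rank (kermx A)].
have KA : K *m A = 0 by apply/sub_kermxP; rewrite eq_row_base.
have XE (i : 'I_(\rank (kermx A))) : X`_i = row i K.
  by rewrite (nth_mktuple (fun i => row i K)).
have freeX : free X.
  apply/freeP => k /= Hk i.
  suff : (\row_j k j) *m K = 0.
    rewrite -[X in _ = X](mul0mx _ K) => /(row_free_inj (row_base_free _)).
    by move/rowP/(_ i); rewrite !mxE.
  rewrite mulmx_sum_row -[RHS]Hk; apply: eq_bigr => j _.
  by rewrite mxE XE.
exists <<X>>%VS; last first.
  by move/eqP: freeX => ->; rewrite size_tuple mxrank_ker.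
move=> v; apply/idP/eqP => [/coord_span -> | vA].
  rewrite mulmx_suml big1 // => i _.
  by rewrite -scalemxAl XE -row_mul KA row0 scaler0.
have /submxP [w ->] : (v <= K)%MS by rewrite eq_row_base; apply/sub_kermxP.
rewrite mulmx_sum_row memv_suml // => i _; rewrite memvZ // memv_span //.
by apply/tnthP; exists i; rewrite tnth_mktuple.
Qed.

(** The matrix C of the restriction satisfies C^2 = -1, so (det C)^2 = (-1)^k
    with k the dimension of [L]. *)
Lemma complex_structure_even_dim (R : realType) d (J : 'M[R]_d)
    (L : {vspace 'rV[R]_d}) :
  J *m J = - 1%:M -> invariant_subspace J L -> ~~ odd (\dim L).
Proof.
move=> JJ LJ; pose b := vbasis L.
have bL (i : 'I_(\dim L)) : b`_i \in L.
  by apply: vbasis_mem; rewrite mem_nth // size_tuple.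
pose C := \matrix_(i < \dim L, j < \dim L) coord b j (b`_i *m J).
have CC : C *m C = - 1%:M.
  apply/matrixP => i j; rewrite !mxE.
  transitivity (coord b j (b`_i *m J *m J)).
    rewrite [in RHS](coord_vbasis (LJ _ (bL i))) mulmx_suml linear_sum /=.
    by apply: eq_bigr => l _; rewrite !mxE -scalemxAl linearZ.
  rewrite -mulmxA JJ mulmxN mulmx1 linearN /= coord_free ?mxE ?[j == i]eq_sym //.
  exact: basis_free (vbasisP L).
have := congr1 determinant CC.
rewrite det_mulmx -scaleN1r detZ det1 mulr1 -signr_odd => E.
apply/negP => dL; move: E; rewrite dL expr1 -expr2 => E.
by have := sqr_ge0 (\det C); rewrite E lerNr oppr0 ler10.
Qed.

(** * Bilinear forms *)

Section BilinearForm.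
Variables (R : comNzRingType) (q : nat) (E : 'M[R]_q).
Implicit Types u v w : 'rV[R]_q.

Definition bform u v : R := (u *m E *m v^T) 0 0.

Lemma bformDl u v w : bform (u + v) w = bform u w + bform v w.
Proof. by rewrite /bform !mulmxDl mxE. Qed.

Lemma bformDr u v w : bform w (u + v) = bform w u + bform w v.
Proof. by rewrite /bform linearD mulmxDr mxE. Qed.

Lemma bformZl a u v : bform (a *: u) v = a * bform u v.
Proof. by rewrite /bform -!scalemxAl mxE. Qed.

Lemma bformZr a u v : bform u (a *: v) = a * bform u v.
Proof. by rewrite /bform linearZ -scalemxAr mxE. Qed.

Lemma bformNl u v : bform (- u) v = - bform u v.
Proof. by rewrite -scaleN1r bformZl mulN1r. Qed.

Lemma bformNr u v : bform u (- v) = - bform u v.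
Proof. by rewrite -scaleN1r bformZr mulN1r. Qed.

Lemma bform0l u : bform 0 u = 0.
Proof. by rewrite -(scale0r 0) bformZl mul0r. Qed.

Lemma bform_sum (I K : finType) (u : I -> 'rV[R]_q) (v : K -> 'rV[R]_q) :
  bform (\sum_i u i) (\sum_k v k) = \sum_i \sum_k bform (u i) (v k).
Proof.
rewrite /bform !mulmx_suml summxE; apply: eq_bigr => i _.
by rewrite linear_sum mulmx_sumr summxE.
Qed.

Lemma bform_sym u v : E^T = E -> bform u v = bform v u.
Proof.
move=> symE; rewrite /bform.
have -> : (u *m E *m v^T) 0 0 = ((u *m E *m v^T)^T) 0 0 by rewrite [RHS]mxE.
by rewrite !trmx_mul trmxK symE mulmxA.
Qed.

Lemma bform_row m n (A : 'M[R]_(m, q)) (B : 'M[R]_(n, q)) i j :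
  bform (row i A) (row j B) = (A *m E *m B^T) i j.
Proof.
rewrite /bform -row_mul !mxE; apply: eq_bigr => k _.
by rewrite !mxE.
Qed.

Definition bformE := (bformDl, bformDr, bformNl, bformNr, bformZl, bformZr).

End BilinearForm.

(** * Flat Hermitian forms *)

Section FlatHermitianForm.
Variables (R : realType) (d q : nat) (J : 'M[R]_d) (E : 'M[R]_q).
Variable S : 'rV[R]_d -> 'M[R]_(d, q).
Hypothesis JJ : J *m J = - 1%:M.
Hypothesis symE : E^T = E.
Hypothesis S_linear : forall t X Y, S (X + t *: Y) = S X + t *: S Y.
Implicit Types X Y Z T W : 'rV[R]_d.

(** A vector-valued bilinear form is given by the matrices [S X] of its partial
    maps, which act on rows. *)
Definition value_form X Y : 'rV[R]_q := Y *m S X.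
Local Notation beta := value_form.
Local Notation ip := (bform E).
Hypothesis beta_sym : forall X Y, beta X Y = beta Y X.

(** The curvature <R(X,Y)Z, W> that the Gauss equation assigns to a second
    fundamental form. *)
Definition gauss_curvature X Y Z W : R :=
  ip (beta Y Z) (beta X W) - ip (beta X Z) (beta Y W).

Hypothesis gauss_curvatureJ : forall X Y Z W,
  gauss_curvature X Y (Z *m J) (W *m J) = gauss_curvature X Y Z W.

(** The matrix of h(X, .), where h is the Hermitian part of the form; the
    complexified target is encoded by its real and imaginary parts, in that
    order. *)
Definition hermitian_mx X : 'M[R]_(d, q + q) :=
  row_mx (S X + J *m S (X *m J)) (J *m S X - S (X *m J)).

Definition hermitian_re X Y : 'rV[R]_q := beta X Y + beta (X *m J) (Y *m J).
Definition hermitian_im X Y : 'rV[R]_q := beta X (Y *m J) - beta (X *m J) Y.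

Lemma hermitian_mxE X Y :
  Y *m hermitian_mx X = row_mx (hermitian_re X Y) (hermitian_im X Y).
Proof.
rewrite /hermitian_mx mul_mx_row !mulmxDr mulmxN !mulmxA.
by rewrite /hermitian_re /hermitian_im /value_form.
Qed.

Lemma hermitian_mx_eq0 X Y :
  Y *m hermitian_mx X = 0 -> hermitian_re X Y = 0 /\ hermitian_im X Y = 0.
Proof.
by rewrite hermitian_mxE => /eqP; rewrite row_mx_eq0 => /andP[/eqP ? /eqP].
Qed.

(** h(X, JY) = - i h(X,Y). *)
Lemma hermitian_mx_kerJ X Y :
  Y *m hermitian_mx X = 0 -> Y *m J *m hermitian_mx X = 0.
Proof.
move=> /hermitian_mx_eq0 [g1 g2].
have JJY : Y *m J *m J = - Y by rewrite -mulmxA JJ mulmxN mulmx1.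
rewrite hermitian_mxE (_ : hermitian_re _ _ = hermitian_im X Y); last first.
  by rewrite /hermitian_re /hermitian_im JJY /value_form !mulNmx.
rewrite (_ : hermitian_im X (Y *m J) = - hermitian_re X Y); last first.
  by rewrite /hermitian_re /hermitian_im JJY /value_form !mulNmx -opprD.
by rewrite g1 g2 oppr0 row_mx0.
Qed.

Lemma hermitian_im_diag Z : hermitian_im Z Z = 0.
Proof. by rewrite /hermitian_im [X in X - _]beta_sym subrr. Qed.

Lemma gauss_curvatureJr X Y Z W :
  gauss_curvature X Y Z (W *m J) = - gauss_curvature X Y (Z *m J) W.
Proof.
rewrite -[LHS]gauss_curvatureJ -mulmxA JJ mulmxN mulmx1.
by rewrite /gauss_curvature /value_form !mulNmx !bformNr; ring.
Qed.

(** Expanded, the difference of the two sides is a sum of eight curvature terms.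
    They cancel in pairs because Z and W may be replaced by JZ and JW in
    R(X,Y,Z,W): four of them by the hypothesis itself, and the others by its
    consequence R(X,Y,Z,JW) = - R(X,Y,JZ,W). *)
Lemma hermitian_flat X Y Z T :
  ip (hermitian_re X Y) (hermitian_re Z T) -
    ip (hermitian_im X Y) (hermitian_im Z T) =
  ip (hermitian_re X T) (hermitian_re Z Y) -
    ip (hermitian_im X T) (hermitian_im Z Y).
Proof.
have r1 := gauss_curvatureJ (X *m J) (Z *m J) T Y.
have r2 := gauss_curvatureJ X Z T Y.
have r3 := gauss_curvatureJr X (Z *m J) T Y.
have r4 := gauss_curvatureJr (X *m J) Z T Y.
have symip u v : ip u v = ip v u by exact: bform_sym.
rewrite /gauss_curvature in r1 r2 r3 r4.
(* The products come out as <X-term, Z-term>; the four curvature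
   identities are put in the same order. *)
rewrite 2!(symip (beta (Z *m J) _)) in r1.
rewrite 2!(symip (beta Z _)) in r2.
rewrite 2!(symip (beta (Z *m J) _)) in r3.
rewrite 2!(symip (beta Z _)) in r4.
rewrite /hermitian_re /hermitian_im !bformE.
lra.
Qed.

(** The vector [X] is one for which h(X, .) has the largest rank; every h(Y, .)
    then maps its kernel into its image, and flatness makes h(Z,Z) null. *)
Lemma regular_kernel_null : exists X, forall Z, Z *m hermitian_mx X = 0 ->
  ip (hermitian_re Z Z) (hermitian_re Z Z) = 0.
Proof.
have [X maxX] : exists X, forall Y,
    (\rank (hermitian_mx Y) <= \rank (hermitian_mx X))%N.
  pose P k := `[< exists X, \rank (hermitian_mx X) = k >].
  have exP : exists k, P k.
    by exists (\rank (hermitian_mx 0)); apply/asboolP; exists 0.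
  have bndP k : P k -> (k <= d)%N by move=> /asboolP [X <-]; apply: rank_leq_row.
  case: (ex_maxnP exP bndP) => k /asboolP [X rX] maxk.
  by exists X => Y; rewrite rX; apply: maxk; apply/asboolP; exists Y.
exists X => Z ZX.
have linh t Y : hermitian_mx (X + t *: Y) = hermitian_mx X + t *: hermitian_mx Y.
  rewrite /hermitian_mx scale_row_mx add_row_mx mulmxDl -scalemxAl !S_linear.
  congr row_mx.
    by rewrite mulmxDr -scalemxAr scalerDr !addrA; congr (_ + _); rewrite addrAC.
  rewrite mulmxDr -scalemxAr scalerBr opprD !addrA.
  by congr (_ - _); rewrite addrAC.
have /submxP [W EW] : (Z *m hermitian_mx Z <= hermitian_mx X)%MS.
  by apply: pencil_kernel_image => // t; rewrite -linh.
move: EW; rewrite !hermitian_mxE => /eq_row_mx [E1 E2].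
have [g1 g2] := hermitian_mx_eq0 ZX.
have := hermitian_flat X W Z Z.
by rewrite -E1 -E2 g1 g2 hermitian_im_diag !bform0l !subr0.
Qed.

Lemma gauss_curvature_plane X Y a b :
  gauss_curvature X (a *: X + b *: Y) (a *: X + b *: Y) X =
  b ^+ 2 * gauss_curvature X Y Y X.
Proof.
set Z := a *: X + b *: Y.
have betaZ W : beta W Z = a *: beta W X + b *: beta W Y.
  by rewrite /value_form /Z mulmxDl -!scalemxAl.
rewrite /gauss_curvature (beta_sym Z X) (beta_sym Y X).
rewrite betaZ (beta_sym Z X) (beta_sym Z Y) !betaZ (beta_sym Y X) !bformE.
have symip u v : ip u v = ip v u by exact: bform_sym.
by rewrite (symip (beta X Y) (beta X X)); ring.
Qed.

(** 4 <a,b> = |a+b|^2 - |a-b|^2, where a+b is null and a-b is not timelike. *)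
Lemma holomorphic_curvature_le0 Z :
  ip (hermitian_re Z Z) (hermitian_re Z Z) = 0 ->
  0 <= ip (beta Z Z - beta (Z *m J) (Z *m J)) (beta Z Z - beta (Z *m J) (Z *m J)) ->
  0 <= ip (beta Z (Z *m J)) (beta Z (Z *m J)) ->
  gauss_curvature Z (Z *m J) (Z *m J) Z <= 0.
Proof.
rewrite /gauss_curvature (beta_sym (Z *m J) Z) /hermitian_re.
move: (beta Z Z) (beta (Z *m J) (Z *m J)) (beta Z (Z *m J)) => u v w.
have symip : ip v u = ip u v by exact: bform_sym.
by rewrite !bformE; lra.
Qed.

End FlatHermitianForm.

(** * The Gauss equation in a chart *)

Section OpenSetCalculus.
Variables (R : realType) (V W : normedModType R).

Lemma eq_on_is_derive (U : set V) (f g : V -> W) (y v : V) (df : W) :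
  open U -> (forall z, U z -> f z = g z) -> U y ->
  is_derive y v f df -> is_derive y v g df.
Proof.
move=> oU fg Uy; apply: near_eq_is_derive.
have nU : nbhs y U by apply: open_nbhs_nbhs.
by apply: filterS nU => z; exact: fg.
Qed.

Lemma is_derive_unique (f : V -> W) (y v : V) (a b : W) :
  is_derive y v f a -> is_derive y v f b -> a = b.
Proof. by move=> [_ <-] [_ <-]. Qed.

Lemma smooth_on_derive (U : set V) (f : V -> W) (v : V) :
  smooth_on U f -> smooth_on U ('D_v f).
Proof. by move=> sf k; have [_] := sf k.+1; exact. Qed.

Lemma smooth_on_is_derive (U : set V) (f : V -> W) (y v : V) :
  smooth_on U f -> U y -> is_derive y v f ('D_v f y).
Proof.
move=> sf Uy; apply: derivableP; apply: diff_derivable.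
by have [df _] := sf 1%N; exact: df.
Qed.

End OpenSetCalculus.

Opaque derive.

Section GaussEquation.
Variables (R : realType) (d q : nat) (U : set 'rV[R]_d).
Variables (G : 'rV[R]_d -> 'M[R]_d) (F : 'rV[R]_d -> 'rV[R]_q) (E : 'M[R]_q).
Hypothesis oU : open U.
Hypothesis symE : E^T = E.
Hypothesis sF : smooth_on U F.
Hypothesis unitG : forall y, U y -> G y \in unitmx.
Hypothesis isoF : forall y, U y -> forall u v : 'rV[R]_d,
  bform E ('D_u F y) ('D_v F y) = inner G y u v.
Implicit Types (y z X Y Z W : 'rV[R]_d) (i j k l : 'I_d).

Local Notation frame i := (delta_mx 0 i : 'rV[R]_d).

(** The immersion is described by matrices whose row [j] belongs to the
    coordinate vector d_j: here the tangent vectors d_j F. *)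
Definition frame_mx y : 'M[R]_(d, q) := \matrix_j 'D_(frame j) F y.

Definition hessian_mx i y : 'M[R]_(d, q) :=
  \matrix_j 'D_(frame i) ('D_(frame j) F) y.

Definition third_mx i j y : 'M[R]_(d, q) :=
  \matrix_k 'D_(frame i) ('D_(frame j) ('D_(frame k) F)) y.

(** The operator nabla_(d_i), row [j] being nabla_(d_i) d_j. *)
Definition connection_mx i y : 'M[R]_d := \matrix_(j, k) christoffel G k i j y.

(** The rows beta(d_i, d_j) of the second fundamental form. *)
Definition second_form_mx i y : 'M[R]_(d, q) :=
  hessian_mx i y - connection_mx i y *m frame_mx y.

Lemma mulmx_coef m n p (A : 'M[R]_(m, n)) (B : 'M[R]_(n, p)) a b :
  (A *m B) a b = \sum_c A a c * B c b.
Proof. exact: mxE. Qed.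

(** With M the metric, P the frame, A the derivative of C_j and H_a - C_a P the
    second fundamental form: the differentiated relation C_j M = H_j E P^T,
    rearranged by means of normality. *)
Lemma gauss_rearrangement (A Ci Cj M : 'M[R]_d) (P Hi Hj T : 'M[R]_(d, q)) :
  Ci *m M = Hi *m E *m P^T -> (Hj - Cj *m P) *m E *m P^T = 0 ->
  A *m M + Cj *m (Hi *m E *m P^T + P *m E *m Hi^T) =
    T *m E *m P^T + Hj *m E *m Hi^T ->
  (A + Cj *m Ci) *m M =
    T *m E *m P^T + (Hj - Cj *m P) *m E *m (Hi - Ci *m P)^T.
Proof.
move=> compat normal Ed.
rewrite [(Hi - _)^T]linearB /= mulmxBr trmx_mul [X in _ - X]mulmxA normal mul0mx.
rewrite subr0 mulmxDl -mulmxA compat !mulmxBl addrA -Ed mulmxDr.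
by rewrite !mulmxA addrA addrK.
Qed.

Lemma is_derive_rows (H : 'I_d -> 'rV[R]_d -> 'rV[R]_q)
    (dH : 'I_d -> 'rV[R]_q) y v :
  (forall j, is_derive y v (H j) (dH j)) ->
  is_derive y v (fun z => \matrix_j H j z) (\matrix_j dH j).
Proof.
move=> HH; apply/is_derive_mxP => a b; rewrite mxE.
have -> : (fun z => (\matrix_j H j z) a b) = (fun z => H a z 0 b).
  by apply/funext => z; rewrite mxE.
by have /is_derive_mxP := HH a; exact.
Qed.

Lemma is_derive_frame_mx i y : U y ->
  is_derive y (frame i) frame_mx (hessian_mx i y).
Proof.
move=> Uy; apply: is_derive_rows => j.
exact: (smooth_on_is_derive _ (smooth_on_derive _ sF) Uy).
Qed.

Lemma is_derive_hessian_mx i j y : U y ->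
  is_derive y (frame i) (hessian_mx j) (third_mx i j y).
Proof.
move=> Uy; apply: is_derive_rows => k.
exact: (smooth_on_is_derive _ (smooth_on_derive _ (smooth_on_derive _ sF)) Uy).
Qed.

Lemma third_mx_sym i j y : U y -> third_mx i j y = third_mx j i y.
Proof.
move=> Uy; apply/row_matrixP => k.
apply: etrans (rowK _ _) (etrans _ (esym (rowK _ _))).
exact: (derive_comm_mx (frame j) (frame i) oU (smooth_on_derive (frame k) sF) Uy).
Qed.

Lemma hessian_mx_sym i j y : U y -> row j (hessian_mx i y) = row i (hessian_mx j y).
Proof.
move=> Uy; apply: etrans (rowK _ _) (etrans _ (esym (rowK _ _))).
exact: (derive_comm_mx (frame j) (frame i) oU sF Uy).
Qed.

Lemma metric_frame_mx y : U y -> frame_mx y *m E *m (frame_mx y)^T = G y.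
Proof.
move=> Uy; apply/matrixP => i j.
rewrite -bform_row !rowK (isoF Uy) /inner -rowE trmx_delta.
by rewrite -colE !mxE.
Qed.

Lemma is_derive_metric i y : U y ->
  is_derive y (frame i) G (hessian_mx i y *m E *m (frame_mx y)^T +
                           frame_mx y *m E *m (hessian_mx i y)^T).
Proof.
move=> Uy; apply: (eq_on_is_derive oU metric_frame_mx Uy).
have dPE := is_derive_mulmxr E (is_derive_frame_mx i Uy).
exact: (is_derive_mulmx dPE (is_derive_trmx (is_derive_frame_mx i Uy))).
Qed.

Lemma pderiv_metric i j k y : U y ->
  pderiv i (fun z => G z j k) y =
  bform E (row j (hessian_mx i y)) (row k (frame_mx y)) +
  bform E (row k (hessian_mx i y)) (row j (frame_mx y)).
Proof.
move=> Uy; have /is_derive_mxP /(_ j k) [_ H] := is_derive_metric i Uy.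
apply: etrans H _; rewrite mxE; congr (_ + _); first exact/esym/bform_row.
by rewrite bform_sym // bform_row.
Qed.

Lemma metric_sym_mx y : U y -> (G y)^T = G y.
Proof.
by move=> Uy; rewrite -metric_frame_mx // !trmx_mul trmxK symE mulmxA.
Qed.

(** The Christoffel symbols are the tangential components of the second
    derivatives: in the Koszul formula the derivatives of the metric are
    expanded by the product rule, and all but two equal terms cancel by
    symmetry of the second derivatives. *)
Lemma connection_mxE i y : U y ->
  connection_mx i y =
  hessian_mx i y *m E *m (frame_mx y)^T *m invmx (G y).
Proof.
move=> Uy; apply/matrixP => j k.
rewrite /connection_mx mxE /christoffel [RHS]mxE mulr_sumr.
apply: eq_bigr => l _.
pose B a b c := bform E (row b (hessian_mx a y)) (row c (frame_mx y)).
have symB a b c : B a b c = B b a c.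
  exact: (congr1 (fun r => bform E r _) (hessian_mx_sym a b Uy)).
have dG a b c : pderiv a (fun z => G z b c) y = B a b c + B a c b.
  exact: pderiv_metric.
have <- : B i j l = (hessian_mx i y *m E *m (frame_mx y)^T) j l.
  exact: bform_row.
rewrite (dG i j l) (dG j i l) (dG l i j).
clearbody B; rewrite (symB j i l) (symB l i j) (symB l j i).
have -> : invmx (G y) l k = invmx (G y) k l.
  by rewrite -[in LHS](metric_sym_mx Uy) -trmx_inv mxE.
by field.
Qed.

Lemma connection_mx_coef i j k y : connection_mx i y j k = christoffel G k i j y.
Proof. by rewrite mxE. Qed.

Lemma row_frame_mx j y : row j (frame_mx y) = 'D_(frame j) F y.
Proof. exact: rowK. Qed.

Opaque frame_mx hessian_mx third_mx connection_mx.

Lemma connection_mx_metric i y : U y ->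
  connection_mx i y *m G y = hessian_mx i y *m E *m (frame_mx y)^T.
Proof. by move=> Uy; rewrite connection_mxE // mulmxKV // unitG. Qed.

Lemma second_form_mx_normal i y : U y ->
  second_form_mx i y *m E *m (frame_mx y)^T = 0.
Proof.
move=> Uy; rewrite /second_form_mx !mulmxBl -connection_mx_metric //.
by rewrite -!mulmxA [frame_mx y *m _]mulmxA metric_frame_mx // subrr.
Qed.

Lemma connection_mx_sym i j y : U y ->
  row j (connection_mx i y) = row i (connection_mx j y).
Proof.
move=> Uy; rewrite (connection_mxE i Uy) (connection_mxE j Uy) !row_mul.
by rewrite (hessian_mx_sym i j Uy).
Qed.

Lemma second_form_mx_sym i j y : U y ->
  row j (second_form_mx i y) = row i (second_form_mx j y).
Proof.
move=> Uy; rewrite /second_form_mx !linearB /= !row_mul.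
by rewrite (hessian_mx_sym i j Uy) (connection_mx_sym i j Uy).
Qed.

Lemma derivable_connection_mx i j y : U y ->
  derivable (connection_mx i) y (frame j).
Proof.
move=> Uy.
have nU : nbhs y U by apply: open_nbhs_nbhs.
have dG : derivable G y (frame j) by case: (is_derive_metric j Uy).
have dV : derivable (fun z => invmx (G z)) y (frame j).
  by apply: derivable_invmx dG _; apply: filterS nU => z; exact: unitG.
have dHE := is_derive_mulmxr E (is_derive_hessian_mx j i Uy).
have dHP := is_derive_mulmx dHE (is_derive_trmx (is_derive_frame_mx j Uy)).
have [dR _] := is_derive_mulmx dHP (derivableP dV).
apply: near_eq_derivable dR.
by apply: filterS nU => z Uz; apply/esym/connection_mxE.
Qed.

Definition dconnection_mx i j y : 'M[R]_d := 'D_(frame i) (connection_mx j) y.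

Lemma is_derive_connection_mx i j y : U y ->
  is_derive y (frame i) (connection_mx j) (dconnection_mx i j y).
Proof. by move=> Uy; apply: derivableP; apply: derivable_connection_mx. Qed.

Definition curvature_mx i j y : 'M[R]_d :=
  \matrix_(k, l) curvature_coef G l i j k y.

Lemma curvature_mxE i j y : U y ->
  curvature_mx i j y = dconnection_mx i j y - dconnection_mx j i y
    + (connection_mx j y *m connection_mx i y
       - connection_mx i y *m connection_mx j y).
Proof.
move=> Uy; have dE a b k l :
    (dconnection_mx a b y) k l = pderiv a (christoffel G l b k) y.
  have /is_derive_mxP /(_ k l) [_ <-] := is_derive_connection_mx a b Uy.
  have -> : christoffel G l b k = fun z => connection_mx b z k l.
    by apply/funext => z; exact/esym/connection_mx_coef.
  by [].
have subE (M N : 'M[R]_d) a b : (M - N) a b = M a b - N a b by rewrite !mxE.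
move: (dE i j) (dE j i); move: (dconnection_mx i j y) (dconnection_mx j i y).
move=> A B EA EB; apply/matrixP => k l; rewrite /curvature_mx mxE /curvature_coef.
rewrite -EA -EB [RHS]mxE [(A - B) k l]subE.
rewrite [(connection_mx j y *m connection_mx i y - _) k l]subE !mulmx_coef -sumrB.
by congr (_ + _); apply: eq_bigr => e _; rewrite -!connection_mx_coef.
Qed.

(** Differentiating C_j G = H_j E P^T gives the tangential part of the third
    derivatives of F, without any derivative of the second fundamental form. *)
Lemma dconnection_mx_metric i j y : U y ->
  (dconnection_mx i j y + connection_mx j y *m connection_mx i y) *m G y =
  third_mx i j y *m E *m (frame_mx y)^T +
  second_form_mx j y *m E *m (second_form_mx i y)^T.
Proof.
move=> Uy.
have d1 := is_derive_mulmx (is_derive_connection_mx i j Uy) (is_derive_metric i Uy).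
have dHE := is_derive_mulmxr E (is_derive_hessian_mx i j Uy).
have d2 := is_derive_mulmx dHE (is_derive_trmx (is_derive_frame_mx i Uy)).
have {}d2 := eq_on_is_derive oU
  (fun z Uz => esym (connection_mx_metric j Uz)) Uy d2.
apply: gauss_rearrangement (connection_mx_metric i Uy) _ (is_derive_unique d1 d2).
exact: second_form_mx_normal.
Qed.

(** Antisymmetrizing in i and j removes the third derivatives of F. *)
Lemma gauss_equation_mx i j y : U y ->
  curvature_mx i j y *m G y =
  second_form_mx j y *m E *m (second_form_mx i y)^T -
  second_form_mx i y *m E *m (second_form_mx j y)^T.
Proof.
move=> Uy.
have -> : curvature_mx i j y =
    (dconnection_mx i j y + connection_mx j y *m connection_mx i y) -
    (dconnection_mx j i y + connection_mx i y *m connection_mx j y).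
  by rewrite curvature_mxE // opprD addrACA.
rewrite mulmxBl !dconnection_mx_metric // (third_mx_sym i j Uy).
by rewrite opprD addrACA subrr add0r.
Qed.

(** Parallelism says d_c J = C_c J - J C_c.  Differentiating this once more, the
    equality of the mixed derivatives of J becomes the commutation with the
    curvature. *)
Lemma curvature_mx_parallel (J : 'rV[R]_d -> 'M[R]_d) i j y :
  smooth_on U J ->
  (forall z, U z -> forall c a b, covariant_deriv G J c a b z = 0) -> U y ->
  curvature_mx i j y *m J y = J y *m curvature_mx i j y.
Proof.
move=> sJ parJ Uy.
have subE (M N : 'M[R]_d) a b : (M - N) a b = M a b - N a b by rewrite !mxE.
have DJ c z : U z ->
    'D_(frame c) J z = connection_mx c z *m J z - J z *m connection_mx c z.
  move=> Uz; apply/matrixP => a b.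
  have /is_derive_mxP /(_ a b) [_ <-] := smooth_on_is_derive (frame c) sJ Uz.
  have := parJ z Uz c a b; rewrite /covariant_deriv => /eqP.
  rewrite addr_eq0 => /eqP; rewrite /pderiv => ->.
  rewrite subE !mulmx_coef -sumrB -sumrN.
  by apply: eq_bigr => e _; rewrite !connection_mx_coef opprB.
pose dJ a := connection_mx a y *m J y - J y *m connection_mx a y.
have DDJ a b : 'D_(frame a) ('D_(frame b) J) y =
    (dconnection_mx a b y *m J y + connection_mx b y *m dJ a) -
    (dJ a *m connection_mx b y + J y *m dconnection_mx a b y).
  have dJP : is_derive y (frame a) J (dJ a).
    exact: is_derive_eq (smooth_on_is_derive (frame a) sJ Uy) (DJ a y Uy).
  have dC := is_derive_connection_mx a b Uy.
  have d1 := is_deriveB (is_derive_mulmx dC dJP) (is_derive_mulmx dJP dC).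
  have d2 := smooth_on_is_derive (frame a) (smooth_on_derive (frame b) sJ) Uy.
  have {}d2 := eq_on_is_derive oU (DJ b) Uy d2.
  exact: is_derive_unique d2 d1.
have comm := derive_comm_mx (frame j) (frame i) oU sJ Uy.
have {comm} := etrans (esym (DDJ i j)) (etrans comm (DDJ j i)).
rewrite (curvature_mxE i j Uy) /dJ => {DDJ DJ dJ}.
move: (dconnection_mx i j y) (dconnection_mx j i y) (J y) => A B K.
move: (connection_mx i y) (connection_mx j y) => P Q.
rewrite !(mulmxDl, mulmxDr, mulNmx, mulmxN) !mulmxA.
move: (A *m K) (K *m A) (B *m K) (K *m B) => AK KA BK KB.
move: (Q *m P *m K) (Q *m K *m P) (P *m K *m Q) (K *m P *m Q) => QPK QKP PKQ KPQ.
move: (P *m Q *m K) (K *m Q *m P) => PQK KQP.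
(* What remains is linear in the noncommutative monomials, hence can be read off
   entry by entry. *)
move=> /matrixP eqH; apply/matrixP => a b.
by move: (eqH a b); rewrite !mxE; lra.
Qed.

Definition second_form X y : 'M[R]_(d, q) := \sum_i X 0 i *: second_form_mx i y.

Lemma second_form_linear t X Y y :
  second_form (X + t *: Y) y = second_form X y + t *: second_form Y y.
Proof.
rewrite /second_form scaler_sumr -big_split /=; apply: eq_bigr => i _.
by rewrite !mxE scalerDl scalerA.
Qed.

Lemma second_form_sym X Y y : U y ->
  Y *m second_form X y = X *m second_form Y y.
Proof.
move=> Uy; rewrite /second_form !mulmx_sumr.
have expand (Z W : 'rV[R]_d) : \sum_i Z *m (W 0 i *: second_form_mx i y) =
    \sum_i \sum_j (W 0 i * Z 0 j) *: row j (second_form_mx i y).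
  apply: eq_bigr => i _; rewrite -scalemxAr mulmx_sum_row scaler_sumr.
  by apply: eq_bigr => j _; rewrite scalerA.
rewrite !expand exchange_big /=; apply: eq_bigr => i _; apply: eq_bigr => j _.
by rewrite (second_form_mx_sym j i Uy) mulrC.
Qed.

Lemma second_form_normal X y : U y ->
  second_form X y *m (E *m (frame_mx y)^T) = 0.
Proof.
move=> Uy; rewrite /second_form mulmx_suml big1 // => i _.
by rewrite -scalemxAl mulmxA second_form_mx_normal // scaler0.
Qed.

Lemma curvature_sum X Y Z y :
  curvature G y X Y Z =
  \sum_i \sum_j (X 0 i * Y 0 j) *: (Z *m curvature_mx i j y).
Proof.
apply/rowP => l; rewrite mxE summxE; apply: eq_bigr => i _.
rewrite summxE; apply: eq_bigr => j _; rewrite mxE mulmx_coef mulr_sumr.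
by apply: eq_bigr => k _; rewrite mxE mulrA.
Qed.

Lemma gauss_equation X Y Z W y : U y ->
  inner G y (curvature G y X Y Z) W =
  gauss_curvature E (second_form ^~ y) X Y Z W.
Proof.
move=> Uy.
have prodE (M N : 'I_d -> 'M[R]_(d, q)) (a b : 'rV[R]_d) :
    bform E (Z *m (\sum_j b 0 j *: N j)) (W *m (\sum_i a 0 i *: M i)) =
    \sum_i \sum_j a 0 i * b 0 j * (Z *m (N j *m E *m (M i)^T) *m W^T) 0 0.
  rewrite !mulmx_sumr bform_sum exchange_big; apply: eq_bigr => i _.
  apply: eq_bigr => j _; rewrite -!scalemxAr bformZl bformZr mulrCA mulrA.
  by rewrite /bform trmx_mul !mulmxA.
rewrite /gauss_curvature /second_form !prodE [X in _ - X]exchange_big /=.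
rewrite -sumrB /inner curvature_sum !mulmx_suml summxE.
apply: eq_bigr => i _; rewrite !mulmx_suml summxE -sumrB.
apply: eq_bigr => j _; rewrite -!scalemxAl mxE -[X in X *m W^T]mulmxA.
rewrite gauss_equation_mx // mulmxBr mulmxBl mxE [X in _ * (_ + X)]mxE.
by rewrite mulrBr [Y 0 j * _]mulrC.
Qed.

Lemma curvature_parallel (J : 'rV[R]_d -> 'M[R]_d) X Y Z y :
  smooth_on U J ->
  (forall z, U z -> forall c a b, covariant_deriv G J c a b z = 0) -> U y ->
  curvature G y X Y (Z *m J y) = curvature G y X Y Z *m J y.
Proof.
move=> sJ parJ Uy; rewrite !curvature_sum mulmx_suml; apply: eq_bigr => i _.
rewrite mulmx_suml; apply: eq_bigr => j _.
by rewrite -scalemxAl -!mulmxA (curvature_mx_parallel i j sJ parJ Uy).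
Qed.

Section Quadric.
Variable c : R.
Hypothesis quadric : forall y, U y -> bform E (F y) (F y) = c.

Lemma frame_mx_position y : U y -> frame_mx y *m E *m (F y)^T = 0.
Proof.
move=> Uy; apply/row_matrixP => j.
rewrite !row_mul row_frame_mx row0.
have dF := smooth_on_is_derive (frame j) sF Uy.
have d1 := is_derive_mulmx (is_derive_mulmxr E dF) (is_derive_trmx dF).
have cF z : U z -> cst (c%:M : 'M[R]_1) z = F z *m E *m (F z)^T.
  by move=> Uz; rewrite [RHS]mx11_scalar; congr _%:M; exact/esym/quadric.
have d2 := eq_on_is_derive oU cF Uy (is_derive_cst (c%:M : 'M[R]_1) y (frame j)).
have := is_derive_unique d1 d2; move: ('D_(frame j) F y) => u /matrixP /(_ 0 0).
rewrite mxE -![(_ *m E *m _) 0 0]/(bform E _ _) (bform_sym (F y) u symE).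
rewrite [RHS]mxE => uF; apply/matrixP => a b; rewrite !ord1 [RHS]mxE.
by rewrite -[LHS]/(bform E u (F y)); lra.
Qed.

(** Since F is orthogonal to the frame, differentiating this orthogonality gives
    <d_i d_j F, F> = - <d_j F, d_i F>, and the tangential part contributes
    nothing. *)
Lemma second_form_position X Y y : U y ->
  bform E (Y *m second_form X y) (F y) = - inner G y X Y.
Proof.
move=> Uy.
have posB i : second_form_mx i y *m E *m (F y)^T =
    - (frame_mx y *m E *m ('D_(frame i) F y)^T).
  have dF := smooth_on_is_derive (frame i) sF Uy.
  have dP := is_derive_mulmxr E (is_derive_frame_mx i Uy).
  have d1 := is_derive_mulmx dP (is_derive_trmx dF).
  have d2 := eq_on_is_derive oU (fun z Uz => esym (frame_mx_position Uz)) Uy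
    (is_derive_cst (0 : 'M[R]_(d, 1)) y (frame i)).
  have /eqP := is_derive_unique d1 d2; rewrite addr_eq0 => /eqP <-.
  rewrite /second_form_mx !mulmxBl -!(mulmxA (connection_mx i y)).
  by rewrite (frame_mx_position Uy) mulmx0 subr0.
have GX : frame_mx y *m E *m (frame_mx y)^T *m X^T =
    \sum_i X 0 i *: (frame_mx y *m E *m ('D_(frame i) F y)^T).
  rewrite -mulmxA -trmx_mul mulmx_sum_row linear_sum /= mulmx_sumr.
  by apply: eq_bigr => i _; rewrite row_frame_mx linearZ /= -scalemxAr.
have SF : second_form X y *m (E *m (F y)^T) = - (G y *m X^T).
  rewrite -(metric_frame_mx Uy) GX /second_form mulmx_suml -sumrN.
  by apply: eq_bigr => i _; rewrite -scalemxAl mulmxA posB scalerN.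
rewrite -[inner G y X Y]/(bform (G y) X Y) (bform_sym X Y (metric_sym_mx Uy)).
by rewrite /bform -!mulmxA SF mulmxN mxE.
Qed.

End Quadric.

End GaussEquation.

(** * The Lorentz form *)

Section LorentzForm.
Variables (R : realType) (N : nat).
Implicit Types u v w : 'rV[R]_N.+1.

Definition lorentz_mx : 'M[R]_N.+1 :=
  diag_mx (\row_k if k == ord0 then -1 else 1).

Lemma lorentz_mx_sym : lorentz_mx^T = lorentz_mx.
Proof. exact: tr_diag_mx. Qed.

Lemma bform_lorentz u v : bform lorentz_mx u v = lorentz u v.
Proof.
rewrite /bform /lorentz_mx mul_mx_diag mxE big_ord_recl !mxE /= /lorentz.
congr (_ + _); first by rewrite mulrN1 mulNr.
by apply: eq_bigr => k _; rewrite !mxE /= mulr1.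
Qed.

(** Subtract from [w] the multiple c u with the same time component: the
    difference has only space components, and its square is <w,w> - c^2. *)
Lemma lorentz_orthogonal_ge0 u w :
  lorentz u u = -1 -> lorentz w u = 0 -> 0 <= lorentz w w.
Proof.
move=> uu wu.
have u0 : u 0 ord0 != 0.
  apply/eqP => u0; move: uu; rewrite /lorentz u0 mulr0 oppr0 add0r => E.
  have : 0 <= \sum_(k < N) u 0 (lift ord0 k) * u 0 (lift ord0 k).
    by apply: sumr_ge0 => k _; rewrite -expr2 sqr_ge0.
  by rewrite E lerNr oppr0 ler10.
pose c := w 0 ord0 / u 0 ord0; pose r := w - c *: u.
have r0 : r 0 ord0 = 0 by rewrite /r /c !mxE divfK // subrr.
have rr : lorentz r r = lorentz w w - c ^+ 2.
  rewrite -!bform_lorentz /r !bformE (bform_sym u w lorentz_mx_sym) !bform_lorentz.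
  by rewrite uu wu; ring.
have : 0 <= lorentz r r.
  rewrite /lorentz r0 mulr0 oppr0 add0r.
  by apply: sumr_ge0 => k _; rewrite -expr2 sqr_ge0.
by rewrite rr; have := sqr_ge0 c; lra.
Qed.

End LorentzForm.

(** * Complex planes of nonpositive curvature *)

Lemma mxrank_row_mx (K : fieldType) m n1 n2
    (A : 'M[K]_(m, n1)) (B : 'M[K]_(m, n2)) :
  (\rank (row_mx A B) <= \rank A + \rank B)%N.
Proof.
rewrite -mxrank_tr tr_row_mx -(mxrank_tr A) -(mxrank_tr B) -addsmxE.
exact: mxrank_adds_leqif.
Qed.

(** Both the real and the imaginary part take their values in the kernel of
    [C]; for C = E P^T this is the normal space. *)
Lemma hermitian_mx_rank (R : realType) d q k (J : 'M[R]_d)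
    (S : 'rV[R]_d -> 'M[R]_(d, q)) (C : 'M[R]_(q, k)) X :
  (forall Y, S Y *m C = 0) ->
  (\rank (hermitian_mx J S X) <= 2 * (q - \rank C))%N.
Proof.
move=> SC.
have rk (A : 'M[R]_(d, q)) : A *m C = 0 -> (\rank A <= q - \rank C)%N.
  by move=> AC; rewrite leq_subRL ?rank_leq_row // addnC mulmx0_rank_max.
rewrite mul2n -addnn (leq_trans (mxrank_row_mx _ _)) // leq_add // rk //.
  by rewrite mulmxDl -mulmxA !SC mulmx0 addr0.
by rewrite mulmxBl -mulmxA !SC mulmx0 subr0.
Qed.

Lemma gram_plane (R : comNzRingType) q (E : 'M[R]_q) (u v : 'rV[R]_q) a b :
  E^T = E ->
  bform E u u * bform E (a *: u + b *: v) (a *: u + b *: v) -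
    bform E u (a *: u + b *: v) ^+ 2 =
  b ^+ 2 * (bform E u u * bform E v v - bform E u v ^+ 2).
Proof.
move=> symE; rewrite !bformE (bform_sym v u symE); ring.
Qed.

Lemma posdef_unitmx (R : realType) d (G : 'M[R]_d) :
  (forall u : 'rV[R]_d, u != 0 -> 0 < (u *m G *m u^T) 0 0) -> G \in unitmx.
Proof.
move=> posG; rewrite unitmxE unitfE; apply/negP => /det0P [u u0 uG].
by have := posG u u0; rewrite uG mul0mx mxE ltxx.
Qed.

(** Write X J = c X + e Y.  If e = 0 then applying J again gives c^2 = -1. *)
Lemma complex_plane_basis (R : realType) d (J : 'M[R]_d) (P : {vspace 'rV[R]_d})
    (X Y : 'rV[R]_d) :
  J *m J = - 1%:M -> complex_plane J P -> basis_of P [:: X; Y] ->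
  exists a b, Y = a *: X + b *: (X *m J).
Proof.
move=> JJ [_ PJ] /andP [/eqP spanP freeXY].
have X0 : X != 0 by apply: free_not0 freeXY _; exact: mem_head.
have : X *m J \in P by apply: PJ; rewrite -spanP memv_span // mem_head.
rewrite -spanP span_cons span_seq1 => /memv_addP [_ /vlineP [c ->]].
case=> _ /vlineP [e ->] XJ.
have e0 : e != 0.
  apply/eqP => e0; move: XJ; rewrite e0 scale0r addr0 => XJ.
  have : X *m J *m J = - X by rewrite -mulmxA JJ mulmxN mulmx1.
  rewrite XJ -scalemxAl XJ scalerA => /eqP.
  rewrite -subr_eq0 opprK -{2}(scale1r X) -scalerDl scaler_eq0 (negPf X0) orbF.
  by rewrite -expr2 gt_eqF // ltr_wpDl ?sqr_ge0 // ltr01.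
exists (- (c / e)), e^-1.
rewrite XJ scalerDr !scalerA mulVf // scale1r addrA -scalerDl.
by rewrite [e^-1 * c]mulrC addNr scale0r add0r.
Qed.

Section HyperbolicKaehlerChart.
Variables (R : realType) (d p : nat) (U : set 'rV[R]_d).
Variables (G J : 'rV[R]_d -> 'M[R]_d) (F : 'rV[R]_d -> 'rV[R]_(d + p).+1).
Hypothesis oU : open U.
Hypothesis sF : smooth_on U F.
Hypothesis sJ : smooth_on U J.
Hypothesis posG : forall y, U y ->
  forall u : 'rV[R]_d, u != 0 -> 0 < inner G y u u.
Hypothesis JJ : forall y, U y -> J y *m J y = - 1%:M.
Hypothesis orthoJ : forall y, U y -> forall u v : 'rV[R]_d,
  inner G y (u *m J y) (v *m J y) = inner G y u v.
Hypothesis parJ : forall y, U y -> forall c a b, covariant_deriv G J c a b y = 0.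
Hypothesis isoF : forall y, U y -> forall u v : 'rV[R]_d,
  lorentz ('D_u F y) ('D_v F y) = inner G y u v.
Hypothesis hypF : forall y, U y -> lorentz (F y) (F y) = -1.

Let E := lorentz_mx R (d + p).

(** The planes are given here by the pair X, aX + bJX; the sectional curvature
    of such a pair is b^2 times that of X, JX over the same multiple of a Gram
    determinant. *)
Lemma nonpositive_holomorphic_curvature_subspace y : U y ->
  exists L : {vspace 'rV[R]_d},
  [/\ (d - 2 * p.+1 <= \dim L)%N, invariant_subspace (J y) L &
      forall X a b, X \in L ->
        sectional_curvature G y X (a *: X + b *: (X *m J y)) <= 0].
Proof.
move=> Uy; have symE : E^T = E := lorentz_mx_sym R (d + p).
have isoE z : U z -> forall u v : 'rV[R]_d,
    bform E ('D_u F z) ('D_v F z) = inner G z u v.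
  by move=> Uz u v; rewrite bform_lorentz isoF.
have hypE z : U z -> bform E (F z) (F z) = -1.
  by move=> Uz; rewrite bform_lorentz hypF.
have unitG z : U z -> G z \in unitmx by move=> Uz; apply/posdef_unitmx/posG.
have symG : (G y)^T = G y := metric_sym_mx symE isoE Uy.
pose S X := second_form G F X y.
have S_lin t X Y : S (X + t *: Y) = S X + t *: S Y by exact: second_form_linear.
have S_sym X Y : value_form S X Y = value_form S Y X.
  exact: (second_form_sym oU symE sF isoE X Y Uy).
have gauss X Y Z W : inner G y (curvature G y X Y Z) W =
    gauss_curvature E S X Y Z W := gauss_equation oU symE sF unitG isoE X Y Z W Uy.
have gaussJ X Y Z W :
    gauss_curvature E S X Y (Z *m J y) (W *m J y) = gauss_curvature E S X Y Z W.
  rewrite -!gauss.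
  by rewrite (curvature_parallel oU symE sF unitG isoE X Y Z sJ parJ Uy) orthoJ.
have position X Y : bform E (value_form S X Y) (F y) = - inner G y X Y.
  exact: (second_form_position oU symE sF isoE hypE X Y Uy).
have [X0 nullX0] := regular_kernel_null (JJ Uy) symE S_lin S_sym gaussJ.
have [L memL dimL] := vspace_of_kernel (hermitian_mx (J y) S X0).
exists L; split.
- pose C := E *m (frame_mx F y)^T.
  have SC X : S X *m C = 0 := second_form_normal oU symE sF unitG isoE X Uy.
  have rC : \rank C = d.
    apply/eqP; rewrite eqn_leq rank_leq_col /=.
    rewrite -[X in (X <= _)%N](mxrank_unit (unitG _ Uy)).
    by rewrite -(metric_frame_mx isoE Uy) -mulmxA mxrankM_maxr.
  rewrite dimL leq_sub2l // (leq_trans (hermitian_mx_rank (J y) X0 SC)) // rC.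
  by rewrite -addnS addKn.
- move=> X; rewrite !memL => /eqP XL; apply/eqP.
  exact: (hermitian_mx_kerJ (JJ Uy) XL).
move=> X a b; rewrite memL => /eqP /nullX0 nullX.
have gXJ : inner G y X (X *m J y) = 0.
  have := orthoJ Uy X (X *m J y).
  rewrite -mulmxA JJ // mulmxN mulmx1 -![inner G y _ _]/(bform (G y) _ _) bformNr.
  by rewrite (bform_sym _ _ symG); lra.
rewrite /sectional_curvature gauss (gauss_curvature_plane symE S_sym).
rewrite -![inner G y _ _]/(bform (G y) _ _) (gram_plane _ _ _ _ symG).
have ge0G u : 0 <= bform (G y) u u.
  have [->|u0] := eqVneq u 0; first by rewrite bform0l lexx.
  exact/ltW/(posG Uy u0).
rewrite [bform (G y) X (X *m J y)]gXJ expr0n subr0.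
apply: mulr_le0_ge0; last first.
  by rewrite invr_ge0 mulr_ge0 ?sqr_ge0 // mulr_ge0.
apply: mulr_ge0_le0; first exact: sqr_ge0.
have spacelike w : bform E w (F y) = 0 -> 0 <= bform E w w.
  rewrite !bform_lorentz => wF; exact: lorentz_orthogonal_ge0 (hypF Uy) wF.
apply: (holomorphic_curvature_le0 symE S_sym nullX).
  by apply: spacelike; rewrite bformDl bformNl !position orthoJ // subrr.
by apply: spacelike; rewrite position gXJ oppr0.
Qed.

End HyperbolicKaehlerChart.

(* T_x M is identified with 'rV[R]_(2 * n) by the chart i; K_P is computed from
   an arbitrary basis X, Y of the plane P. *)
Theorem theorem7 (R : realType) (n p : nat) (hp : (p + 2 <= n)%N)
    (M : smooth_manifold R (2 * n)%N)
    (g J : chart_index M -> 'rV[R]_(2 * n)%N -> 'M[R]_(2 * n)%N)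
    (hM : is_kaehler g J)
    (f : M -> 'rV[R]_(2 * n + p)%N.+1)
    (hf : is_isometric_immersion_hyperbolic g f)
    (x : M) (i : chart_index M) (hx : chart_dom i x) :
  exists (m : nat) (L : {vspace 'rV[R]_(2 * n)%N}),
    [/\ (n - p - 1 <= m)%N,
        \dim L = (2 * m)%N,
        invariant_subspace (J i (chart i x)) L
      & forall P : {vspace 'rV[R]_(2 * n)%N},
          complex_plane (J i (chart i x)) P -> (P <= L)%VS ->
          forall X Y : 'rV[R]_(2 * n)%N, basis_of P [:: X; Y] ->
            sectional_curvature (g i) (chart i x) X Y <= 0 ].
Proof.
have Ux : chart_image i (chart i x) by exists x.
have hyp z : chart_image i z ->
    lorentz ((f \o @param R _ M i) z) ((f \o @param R _ M i) z) = -1.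
  by move=> _; case: (immersion_range hf (param i z)).
have [L [dimL JL curvL]] := nonpositive_holomorphic_curvature_subspace
  (@chart_image_open _ _ M i) (immersion_smooth hf i)
  (endo_smooth (kaehler_endo hM) i) (metric_posdef (kaehler_metric hM) (i := i))
  (kaehler_square hM (i := i)) (kaehler_orthogonal hM (i := i))
  (kaehler_parallel hM (i := i)) (immersion_isometric hf (i := i)) hyp Ux.
have JJ := kaehler_square hM Ux.
have evenL := complex_structure_even_dim JJ JL.
have dimL2 : \dim L = (2 * (\dim L)./2)%N by rewrite [RHS]mul2n even_halfK.
exists (\dim L)./2, L; split => //.
  rewrite -(leq_pmul2l (m := 2)) // -dimL2 (leq_trans _ dimL) //.
  by rewrite -subnDA addn1 mulnBr.
move=> P planeP PL X Y basisP.
have [a [b ->]] := complex_plane_basis JJ planeP basisP.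
apply: curvL; apply: (subvP PL); apply: basis_mem basisP _; exact: mem_head.
Qed.
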